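(* Let $\mathcal Q$ be an almost structurally complete quasivariety and let $\mathbf F$ be the free algebra for $\mathcal Q$ of denumerable rank. Then the following are equivalent: (1) $\mathcal Q$ is structurally complete; (2) every nontrivial algebra in $\mathcal Q$ admits a homomorphism into some elementary extension of $\mathbf F$; (3) every nontrivial $\mathcal Q$-finitely presented algebra admits a homomorphism into $\mathbf F$.
   Context: A quasivariety is a class of algebras of a fixed language defined by quasi-identities $(\forall\bar x)[\varphi(\bar x)\to\psi(\bar x)]$, where $\varphi$ (the premise) is a finite (possibly empty) conjunction of equations and $\psi$ is an equation. $\mathbf F$ is the free algebra for $\mathcal Q$ over a countably infinite set of variables $\{v_0,v_1,\dots\}$, and $\mathbf F(k)$ the free algebra for $\mathcal Q$ over $\{v_0,\dots,v_{k-1}\}$. A quasi-identity is $\mathcal Q$-admissible if it holds in $\mathbf F$. A $\mathcal Q$-admissible quasi-identity $(\forall\bar x)[\varphi(\bar x)\to\psi(\bar x)]$ is $\mathcal Q$-passive if $\mathbf F\models(\forall\bar x)\neg\varphi(\bar x)$, and $\mathcal Q$-active otherwise. $\mathcal Q$ is structurally complete if every $\mathcal Q$-admissible quasi-identity holds in $\mathcal Q$; it is almost structurally complete if every $\mathcal Q$-active quasi-identity holds in $\mathcal Q$. For an algebra $\mathbf A$, a congruence $\alpha$ is a $\mathcal Q$-congruence if $\mathbf A/\alpha\in\mathcal Q$; for $H\subseteq A^2$, $\theta_{\mathcal Q}(H)$ is the least $\mathcal Q$-congruence containing $H$. An algebra is $\mathcal Q$-finitely presented if it is isomorphic to $\mathbf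 F(k)/\theta_{\mathcal Q}(H)$ for some natural number $k$ and finite $H\subseteq F(k)^2$. An algebra is trivial if it has one element. *)

(* Defs.v *)
From Stdlib Require Import List RelationClasses.
From mathcomp Require Import all_boot.
From mathcomp Require Import boolp classical_sets functions cardinality.

Set Implicit Arguments.
Unset Strict Implicit.
Unset Printing Implicit Defensive.

(* An algebraic language: arbitrarily many operation symbols, each of finite
   arity; constants are the symbols of arity 0. *)
Record language := Language { op :> Type; arity : op -> nat }.

(* As usual in universal algebra, carriers are nonempty. *)
Record algebra (L : language) := Algebra {
  carrier :> Type;
  interp : forall f : L, ('I_(arity f) -> carrier) -> carrier;
  carrier_inhabited : inhabited carrier }.

Definition trivial L (A : algebra L) : Prop := exists a : A, forall b : A, b = a.

Definition is_hom L (A B : algebra L) (h : A -> B) : Prop :=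
  forall (f : L) (x : 'I_(arity f) -> A), h (interp x) = interp (fun i => h (x i)).

Definition admits_hom L (A B : algebra L) : Prop := exists h : A -> B, is_hom h.

Definition isomorphic L (A B : algebra L) : Prop :=
  exists h : A -> B, is_hom h /\ bijective h.

Inductive term (L : language) (X : Type) : Type :=
| Var of X
| App (f : L) of ('I_(arity f) -> term L X).

Fixpoint eval L (A : algebra L) X (e : X -> A) (t : term L X) : A :=
  match t with
  | Var x => e x
  | App f ts => interp (fun i => eval e (ts i))
  end.

Definition equation L := (term L nat * term L nat)%type.

Definition eq_holds L (A : algebra L) (e : nat -> A) (p : equation L) : Prop :=
  eval e p.1 = eval e p.2.

Record quasi_identity L := QuasiIdentity {
  premise : seq (equation L);
  conclusion : equation L }.

Definition premise_holds L (A : algebra L) (e : nat -> A) (q : quasi_identity L) : Prop :=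
  Forall (eq_holds e) (premise q).

Definition qi_holds L (A : algebra L) (q : quasi_identity L) : Prop :=
  forall e : nat -> A, premise_holds e q -> eq_holds e (conclusion q).

Definition quasivariety L (Q : algebra L -> Prop) : Prop :=
  exists S : quasi_identity L -> Prop,
    forall A : algebra L, Q A <-> (forall q, S q -> qi_holds A q).

Record congruence L (A : algebra L) := Congruence {
  cong_rel :> A -> A -> Prop;
  cong_equiv : Equivalence cong_rel;
  cong_compat : forall (f : L) (x y : 'I_(arity f) -> A),
    (forall i, cong_rel (x i) (y i)) -> cong_rel (interp x) (interp y) }.

Section Quotient.
Variables (L : language) (A : algebra L) (R : congruence A).

Definition quot_carrier : Type := {C : A -> Prop | exists a : A, C = R a}.

Definition quot_class (a : A) : quot_carrier :=
  exist _ (R a) (ex_intro _ a erefl).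

Definition quot_repr (C : quot_carrier) : A := projT1 (cid (proj2_sig C)).

Definition quot_interp (f : L) (x : 'I_(arity f) -> quot_carrier) : quot_carrier :=
  quot_class (interp (fun i => quot_repr (x i))).

Lemma quot_inhabited : inhabited quot_carrier.
Proof. by have [a] := carrier_inhabited A; exists; exact: quot_class a. Qed.

Definition quotient : algebra L := Algebra quot_interp quot_inhabited.

Lemma quot_reprK (C : quotient) : quot_class (quot_repr C) = C.
Proof.
rewrite /quot_class /quot_repr; case: C => C hC /=.
by apply: eq_exist; case: (cid _).
Qed.

Lemma quot_classE (a b : A) : quot_class a = quot_class b <-> R a b.
Proof.
have eR := cong_equiv R; split=> [[E]|ab].
  by rewrite E; apply: reflexivity.
apply: eq_exist; apply: funext => c; apply: propext.
by split=> H; [apply: transitivity H; apply: symmetry|apply: transitivity H].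
Qed.

(* In particular [quot_interp] does not depend on the representatives. *)
Lemma quot_class_hom : is_hom (quot_class : A -> quotient).
Proof.
move=> f x; apply/quot_classE; apply: cong_compat => i.
by apply/quot_classE; rewrite (quot_reprK (quot_class (x i))).
Qed.

Lemma eval_quot X (e : X -> A) (t : term L X) :
  eval (fun x => quot_class (e x) : quotient) t = quot_class (eval e t).
Proof.
elim: t => [//|f ts IH] /=; rewrite quot_class_hom.
by congr (@interp L quotient f _); apply: funext => i; exact: IH.
Qed.

End Quotient.

Definition Q_congruence L (Q : algebra L -> Prop) (A : algebra L) (R : congruence A) : Prop :=
  Q (quotient R).

Section Theta.
Variables (L : language) (Q : algebra L -> Prop) (A : algebra L) (H : set (A * A)).

Definition theta_rel (a b : A) : Prop :=
  forall R : congruence A, Q_congruence Q R -> (forall p, H p -> R p.1 p.2) -> R a b.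

Lemma theta_equiv : Equivalence theta_rel.
Proof.
split=> [a R _ _|a b ab R QR HR|a b c ab bc R QR HR];
  have eR := cong_equiv R; first exact: reflexivity.
- by symmetry; exact: ab.
- by transitivity b; [exact: ab|exact: bc].
Qed.

Lemma theta_compat (f : L) (x y : 'I_(arity f) -> A) :
  (forall i, theta_rel (x i) (y i)) -> theta_rel (interp x) (interp y).
Proof. by move=> xy R QR HR; apply: cong_compat => i; exact: xy. Qed.

(* The intersection of all Q-congruences containing H; the next three lemmas
   show that it is the least Q-congruence containing H. *)
Definition theta : congruence A := Congruence theta_equiv theta_compat.

Lemma theta_sub p : H p -> theta p.1 p.2.
Proof. by move=> Hp R _; apply. Qed.

Lemma theta_min (R : congruence A) :
  Q_congruence Q R -> (forall p, H p -> R p.1 p.2) ->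
  forall a b, theta a b -> R a b.
Proof. by move=> QR HR a b; apply. Qed.

Lemma theta_Q_congruence : quasivariety Q -> Q_congruence Q theta.
Proof.
move=> [S QS]; apply/QS => q Sq e; pose e' n := quot_repr (e n).
have -> : e = fun n => quot_class theta (e' n).
  by apply: funext => n; rewrite [RHS]quot_reprK.
have E R p : eq_holds (A := quotient R) (fun n => quot_class R (e' n)) p <->
             R (eval e' p.1) (eval e' p.2).
  by rewrite /eq_holds !eval_quot; exact: quot_classE.
move=> prem; apply/E => R QR HR; apply/E.
apply: (proj1 (QS _) QR _ Sq); apply: Forall_impl prem => p /E.
by move=> th; apply/E; exact: th.
Qed.

End Theta.

(* The absolutely free algebra over X. The hypothesis [ne] only fails when X is
   empty and L has no constants: there are then no terms over X, and since
   carriers are nonempty, free algebras over X are left undefined. *)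
Definition term_algebra L X (ne : inhabited (term L X)) : algebra L :=
  Algebra (@App L X) ne.

Definition free_algebra L (Q : algebra L -> Prop) X (ne : inhabited (term L X)) : algebra L :=
  quotient (theta Q (set0 : set (term_algebra ne * term_algebra ne))).

(* The free algebra over {v_0, v_1, ...}; v_n is the class of [Var L n]. *)
Definition F_omega L (Q : algebra L -> Prop) : algebra L :=
  free_algebra Q (inhabits (Var L 0)).

(* A is isomorphic to F(k) / theta_Q(H) for some k and some finite H. *)
Definition finitely_presented L (Q : algebra L -> Prop) (A : algebra L) : Prop :=
  exists (k : nat) (ne : inhabited (term L 'I_k))
         (H : set (free_algebra Q ne * free_algebra Q ne)),
    finite_set H /\ isomorphic A (quotient (theta Q H)).

Definition admissible L (Q : algebra L -> Prop) (q : quasi_identity L) : Prop :=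
  qi_holds (F_omega Q) q.

Definition passive L (Q : algebra L -> Prop) (q : quasi_identity L) : Prop :=
  admissible Q q /\ forall e : nat -> F_omega Q, ~ premise_holds e q.

Definition active L (Q : algebra L -> Prop) (q : quasi_identity L) : Prop :=
  admissible Q q /\ ~ passive Q q.

Definition structurally_complete L (Q : algebra L -> Prop) : Prop :=
  forall q, admissible Q q -> forall A, Q A -> qi_holds A q.

Definition almost_structurally_complete L (Q : algebra L -> Prop) : Prop :=
  forall q, active Q q -> forall A, Q A -> qi_holds A q.

(* The remaining connectives and the existential quantifier are classically
   definable from these. *)
Inductive formula (L : language) : Type :=
| FEq of term L nat & term L nat
| FFalse
| FImp of formula L & formula L
| FAll of nat & formula L.

Definition update (T : Type) (e : nat -> T) (n : nat) (a : T) : nat -> T :=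
  fun m => if m == n then a else e m.

Fixpoint sat L (A : algebra L) (e : nat -> A) (phi : formula L) : Prop :=
  match phi with
  | FEq s t => eval e s = eval e t
  | FFalse => False
  | FImp p q => sat e p -> sat e q
  | FAll n p => forall a : A, sat (update e n a) p
  end.

Definition elementary_embedding L (A B : algebra L) (j : A -> B) : Prop :=
  forall (phi : formula L) (e : nat -> A), sat e phi <-> sat (fun n => j (e n)) phi.

(* B is an elementary extension of A, up to identifying A with its image in B.
   That j is injective and a homomorphism follows by taking phi atomic. *)
Definition elementary_extension L (A B : algebra L) : Prop :=
  exists j : A -> B, elementary_embedding j.

(* Main.v *)
From Stdlib Require Import List.
From mathcomp Require Import all_boot.
From mathcomp Require Import boolp classical_sets cardinality filter.
Require Import Defs.

(* (1) => (2): were some finite part of the positive diagram of A unrealizable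
   in F, the quasi-identity "that part implies x = y", with x and y fresh, would
   be admissible, hence true in A, and A would be trivial. So all finite parts
   are realizable in F, and these realizations together define a homomorphism
   from A to an ultrapower of F, with the finite parts as index set.
   (2) => (3): a homomorphism from a finitely presented algebra amounts to a
   solution of finitely many equations in finitely many variables; solvability
   is first-order, so it passes from an elementary extension down to F.
   (3) => (1): by almost structural completeness only passive quasi-identities
   matter. The algebra presented by the premise of a passive one has no
   homomorphism to F, so it is trivial, and hence the premise implies every
   equation throughout Q. *)

Set Implicit Arguments.
Unset Strict Implicit.
Unset Printing Implicit Defensive.

Local Open Scope classical_set_scope.

(** * Terms *)

Fixpoint rename L X Y (s : X -> Y) (t : term L X) : term L Y :=
  match t with
  | Var x => Var L (s x)
  | App f ts => App (fun i => rename s (ts i))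
  end.

Lemma eval_rename L (A : algebra L) X Y (s : X -> Y) (e : Y -> A) (t : term L X) :
  eval e (rename s t) = eval (e \o s) t.
Proof.
elim: t => [//|f ts IH] /=.
by congr (interp _); apply: funext => i; exact: IH.
Qed.

Lemma eval_hom L (A B : algebra L) (h : A -> B) X (e : X -> A) (t : term L X) :
  is_hom h -> eval (h \o e) t = h (eval e t).
Proof.
move=> hh; elim: t => [//|f ts IH] /=; rewrite hh.
by congr (interp _); apply: funext => i; exact: IH.
Qed.

Lemma eval_Var L X (ne : inhabited (term L X)) (t : term L X) :
  eval (A := term_algebra ne) (@Var L X) t = t.
Proof.
elim: t => [//|f ts IH] /=.
by congr (App _); apply: funext => i; exact: IH.
Qed.

(** Allows a quasi-identity, written with variables from all of [nat], to be moved to the finitely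
    many generators of a free algebra. The bound depends on the term alone and serves every
    algebra. *)
Lemma eval_finite_support L (t : term L nat) :
  exists k, forall (A : algebra L) (e e' : nat -> A),
    (forall n, n < k -> e n = e' n) -> eval e t = eval e' t.
Proof.
elim: t => [n|f ts /choice[b bP]]; first by exists n.+1 => A e e' /(_ n); apply.
exists (\max_i b i) => A e e' ee' /=; congr (interp _); apply: funext => i.
by apply: bP => n /leq_trans nb; apply/ee'/nb; exact: leq_bigmax.
Qed.

Lemma equation_finite_support L (p : equation L) :
  exists k, forall (A : algebra L) (e e' : nat -> A),
    (forall n, n < k -> e n = e' n) -> eq_holds e p <-> eq_holds e' p.
Proof.
have [k kP] := eval_finite_support p.1; have [l lP] := eval_finite_support p.2.
exists (maxn k l) => A e e' ee'; rewrite /eq_holds (kP _ e e') ?(lP _ e e') //.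
  by move=> n nk; apply: ee'; rewrite leq_max nk orbT.
by move=> n nk; apply: ee'; rewrite leq_max nk.
Qed.

Lemma equations_finite_support L (s : seq (equation L)) :
  exists k, forall (A : algebra L) (e e' : nat -> A),
    (forall n, n < k -> e n = e' n) ->
    Forall (fun p => eq_holds e p <-> eq_holds e' p) s.
Proof.
elim: s => [|p s [k kP]]; first by exists 0 => *; constructor.
have [l lP] := equation_finite_support p.
exists (maxn k l) => A e e' ee'; constructor.
  by apply: lP => n nk; apply: ee'; rewrite leq_max nk orbT.
by apply: kP => n nk; apply: ee'; rewrite leq_max nk.
Qed.

(** * Homomorphisms and presented algebras *)

Lemma hom_comp L (A B C : algebra L) (g : B -> C) (h : A -> B) :
  is_hom g -> is_hom h -> is_hom (g \o h).
Proof. by move=> gh hh f x /=; rewrite hh gh. Qed.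

Lemma qi_holds_inj L (A B : algebra L) (h : A -> B) (q : quasi_identity L) :
  is_hom h -> injective h -> qi_holds B q -> qi_holds A q.
Proof.
move=> hh hI qB e prem; apply: hI; rewrite -!eval_hom //; apply: qB.
by apply: Forall_impl prem => p; rewrite /eq_holds !eval_hom // => ->.
Qed.

Lemma quasivariety_inj L (Q : algebra L -> Prop) (A B : algebra L) (h : A -> B) :
  quasivariety Q -> is_hom h -> injective h -> Q B -> Q A.
Proof.
move=> [S SP] hh hI /SP QB; apply/SP => q /QB; exact: qi_holds_inj.
Qed.

Section Kernel.
Variables (L : language) (A B : algebra L) (h : A -> B).
Hypothesis hh : is_hom h.

Lemma ker_equiv : RelationClasses.Equivalence (fun a b => h a = h b).
Proof. by split=> [a|a b|a b c ->]. Qed.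

Lemma ker_compat (f : L) (x y : 'I_(arity f) -> A) :
  (forall i, h (x i) = h (y i)) -> h (interp x) = h (interp y).
Proof. by move=> xy; rewrite !hh; congr (interp _); apply: funext. Qed.

Definition ker : congruence A := Congruence ker_equiv ker_compat.

Lemma quotient_lift (R : congruence A) : (forall a b, R a b -> h a = h b) ->
  exists g : quotient R -> B, is_hom g /\ forall a, g (quot_class R a) = h a.
Proof.
move=> Rh; pose g (C : quotient R) := h (quot_repr C).
have gE a : g (quot_class R a) = h a.
  by apply: Rh; apply/quot_classE; rewrite (quot_reprK (quot_class R a)).
exists g; split=> // f x.
have -> : x = fun i => quot_class R (quot_repr (x i)).
  by apply: funext => i; rewrite [RHS]quot_reprK.
rewrite -quot_class_hom gE hh; congr (interp _).
by apply: funext => i; rewrite gE.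
Qed.

(** The quotient by the kernel embeds into [B], and quasi-identities pass to subalgebras. *)
Lemma ker_Q_congruence (Q : algebra L -> Prop) :
  quasivariety Q -> Q B -> Q_congruence Q ker.
Proof.
move=> hQ; have [//|g [gh gE]] := @quotient_lift ker.
apply: quasivariety_inj hQ gh _ => C D.
by rewrite -[C]quot_reprK -[D]quot_reprK !gE => CD; apply/quot_classE.
Qed.

(** The kernel of [h] is one of the Q-congruences intersected in [theta]. *)
Lemma theta_lift (Q : algebra L -> Prop) (H : set (A * A)) :
  quasivariety Q -> Q B -> (forall p, H p -> h p.1 = h p.2) ->
  exists g : quotient (theta Q H) -> B,
    is_hom g /\ forall a, g (quot_class _ a) = h a.
Proof.
move=> hQ QB Hh; apply: quotient_lift; apply: (theta_min (R := ker)) => //.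
exact: ker_Q_congruence.
Qed.

End Kernel.

Section Presented.
Variables (L : language) (Q : algebra L -> Prop) (hQ : quasivariety Q).
Variables (X : Type) (ne : inhabited (term L X)).

Definition free_class (t : term L X) : free_algebra Q ne :=
  @quot_class L (term_algebra ne) _ t.

Lemma eval_free_class (t : term L X) : eval (free_class \o @Var L X) t = free_class t.
Proof.
have := eval_hom (A := term_algebra ne) (@Var L X) t (quot_class_hom (theta Q set0)).
by rewrite eval_Var.
Qed.

Lemma free_lift (B : algebra L) (g : X -> B) : Q B ->
  exists h : free_algebra Q ne -> B, is_hom h /\ forall t, h (free_class t) = eval g t.
Proof. by move=> QB; apply: theta_lift. Qed.

Variable H : set (free_algebra Q ne * free_algebra Q ne).

Definition presented_class (t : term L X) : quotient (theta Q H) :=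
  quot_class _ (free_class t).

Lemma eval_presented_class (B : algebra L) (h : quotient (theta Q H) -> B) :
  is_hom h -> forall t,
  eval (h \o (presented_class \o @Var L X)) t = h (presented_class t).
Proof.
move=> hh t.
rewrite (eval_hom _ _ hh) (eval_hom (free_class \o @Var L X) t (quot_class_hom _)).
by rewrite eval_free_class.
Qed.

(** One choice of terms per relation suffices, since the lift from the free algebra is already
    defined on classes. *)
Lemma presented_lift (B : algebra L) (g : X -> B) : Q B ->
  (forall p, H p -> exists s t,
    p = (free_class s, free_class t) /\ eval g s = eval g t) ->
  exists h : quotient (theta Q H) -> B,
    is_hom h /\ forall t, h (presented_class t) = eval g t.
Proof.
move=> QB Hg; have [h [hh hE]] := free_lift g QB.
have [_ /Hg[s [t [-> st]]]|k [kh kE]] := theta_lift (H := H) hh hQ QB.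
  by rewrite !hE.
by exists k; split=> // t; rewrite kE hE.
Qed.

End Presented.

Lemma F_omega_Q L (Q : algebra L -> Prop) : quasivariety Q -> Q (F_omega Q).
Proof. exact: theta_Q_congruence. Qed.

Lemma finite_set_In T (H : set T) :
  finite_set H <-> exists s : seq T, forall x, H x <-> In x s.
Proof.
have inP (s : seq {classic T}) x : x \in s <-> In x s.
  elim: s => [//|y s IH]; rewrite inE /=; split.
    by move=> /orP[/eqP->|/IH]; [left|right].
  by move=> [->|/IH->]; rewrite ?eqxx ?orbT.
split=> [/(@finite_seqP {classic T})[s ->]|[s sP]]; first by exists s => x; exact: inP.
apply/(@finite_seqP {classic T}); exists s.
by apply/seteqP; split=> x /=; [move=> /sP /inP|move=> /inP /sP].
Qed.

(** * First-order formulas *)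

(** The negated conjunction, curried to fit the primitive connectives. Its [universal_closure] over
    the variables of [s] says that [s] has no solution. *)
Fixpoint refutation L (s : seq (equation L)) : formula L :=
  if s is p :: s' then FImp (FEq p.1 p.2) (refutation s') else FFalse L.

Lemma sat_refutation L (A : algebra L) (e : nat -> A) s :
  sat e (refutation s) <-> ~ Forall (eq_holds e) s.
Proof.
elim: s => [|p s IH] /=; first by split=> // /(_ (Forall_nil _)).
rewrite IH; split=> [H /Forall_cons_iff[/H]//|H Hp Hs].
by apply: H; constructor.
Qed.

Fixpoint universal_closure L k (phi : formula L) : formula L :=
  if k is l.+1 then universal_closure l (FAll l phi) else phi.

Lemma sat_universal_closure L (A : algebra L) k (phi : formula L) (e : nat -> A) :
  sat e (universal_closure k phi) <->
  forall e' : nat -> A, (forall n, k <= n -> e' n = e n) -> sat e' phi.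
Proof.
elim: k phi => [|k IH] phi /=.
  split=> [He e' ee'|]; last exact.
  by have -> : e' = e by apply: funext => n; exact: ee'.
rewrite IH /=; split=> H e' ee'.
  (* Resetting [e'] at [k] to [e k] gives an assignment that agrees with [e] from [k] on; the
     quantifier over variable [k] then restores [e' k]. *)
  have -> : e' = update (update e' k (e k)) k (e' k).
    by apply: funext => n; rewrite /update; case: eqP => // ->.
  apply: H => n kn; rewrite /update; case: eqP => [->//|/eqP nk].
  by apply: ee'; rewrite ltn_neqAle eq_sym nk.
move=> a; apply: H => n kn; rewrite /update gtn_eqF //; apply: ee'; exact: ltnW.
Qed.

Definition rename_eq L X Y (s : X -> Y) (p : term L X * term L X) :=
  (rename s p.1, rename s p.2).

Lemma eq_holds_rename L (A : algebra L) X (s : X -> nat) (e : nat -> A) p :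
  eq_holds e (rename_eq s p) <-> eval (e \o s) p.1 = eval (e \o s) p.2.
Proof. by rewrite /eq_holds !eval_rename. Qed.

Lemma eq_holds_comp L (A : algebra L) X (s : nat -> X) (e : X -> A) p :
  eq_holds (e \o s) p <-> eval e (rename_eq s p).1 = eval e (rename_eq s p).2.
Proof. by rewrite /eq_holds !eval_rename. Qed.

Lemma elementary_extension_solution L (A B : algebra L) k
    (s : seq (term L 'I_k * term L 'I_k)) (g : 'I_k -> B) :
  elementary_extension A B ->
  (forall p, In p s -> eval g p.1 = eval g p.2) ->
  exists g' : 'I_k -> A, forall p, In p s -> eval g' p.1 = eval g' p.2.
Proof.
move=> [j jE] sg; have [a0] := carrier_inhabited A.
pose s' := map (rename_eq (@nat_of_ord k)) s.
suff [e eP] : exists e : nat -> A, Forall (eq_holds e) s'.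
  exists (e \o @nat_of_ord k) => p ps; apply/eq_holds_rename.
  by move/Forall_forall: eP; apply; exact: in_map.
apply: contrapT => /forallNP sA.
have : sat (fun=> a0) (universal_closure k (refutation s')).
  by apply/sat_universal_closure => e _; apply/sat_refutation/sA.
move/jE/sat_universal_closure.
(* The closure leaves variables from [k] on at their transferred value, so the default must be
   [j a0]. *)
pose e n := if insub n is Some i then g i else j a0.
have eg : e \o @nat_of_ord k = g by apply: funext => i; rewrite /e /= valK.
move=> /(_ e); case/(_ _)/sat_refutation => [n kn|].
  by rewrite /e insubF // ltnNge kn.
apply/Forall_forall => _ /in_map_iff[p [<- ps]].
by apply/eq_holds_rename; rewrite eg; exact: sg.
Qed.

(** * Ultrapowers *)

Section Ultrapower.
Variables (L : language) (A : algebra L) (I : Type) (U : set_system I).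
Hypothesis hU : UltraFilter U.

Lemma power_inhabited : inhabited (I -> A).
Proof. by have [a] := carrier_inhabited A; exists; exact: (fun=> a). Qed.

Definition power : algebra L :=
  Algebra (fun f (x : 'I_(arity f) -> I -> A) i => interp (x^~ i)) power_inhabited.

Lemma eval_power X (e : X -> power) (t : term L X) (i : I) :
  eval e t i = eval (e^~ i) t.
Proof.
elim: t => [//|f ts IH] /=.
by congr (interp _); apply: funext => n; exact: IH.
Qed.

Lemma almost_eq_equiv :
  RelationClasses.Equivalence (fun x y : power => U [set i | x i = y i]).
Proof.
split=> [x|x y|x y z xy yz]; first by apply: filterS filterT => i.
  by apply: filterS => i.
by apply: filterS (filterI xy yz) => i [/= -> ->].
Qed.

(** Finiteness of arities enters here: it makes almost equality a congruence. *)
Lemma filter_forall_ord n (P : 'I_n -> set I) :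
  (forall k, U (P k)) -> U [set i | forall k, P k i].
Proof.
move=> UP.
suff H : forall s : seq _, U [set i | forall k, k \in s -> P k i].
  by apply: filterS (H (enum (ordinal n))) => i Pi k; apply: Pi; rewrite mem_enum.
elim=> [|l s IH]; first by apply: filterS filterT.
apply: filterS (filterI (UP l) IH) => i [Pl Ps] k.
by rewrite inE => /orP[/eqP->|/Ps].
Qed.

Lemma almost_eq_compat (f : L) (x y : 'I_(arity f) -> power) :
  (forall n, U [set i | x n i = y n i]) ->
  U [set i | interp x i = interp y i].
Proof.
move=> /filter_forall_ord; apply: filterS => i /= xy.
by congr (interp _); exact: funext.
Qed.

Definition almost_eq : congruence power := Congruence almost_eq_equiv almost_eq_compat.

Definition ultrapower : algebra L := quotient almost_eq.

Definition ultra_class (x : I -> A) : ultrapower := @quot_class L power almost_eq x.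

(** Falsity uses that [U] is proper, implication that [U] contains each set or its complement, and
    the quantifier a choice of counterexamples. *)
Lemma Los (phi : formula L) (e : nat -> I -> A) :
  sat (fun n => ultra_class (e n)) phi <-> U [set i | sat (e^~ i) phi].
Proof.
elim: phi e => [s t||p IHp q IHq|n p IH] e /=.
- rewrite !(eval_quot almost_eq (e : nat -> power)).
  split=> [/quot_classE|H]; last apply/quot_classE; rewrite /=.
    by apply: filterS => i; rewrite /= !eval_power.
  by move: H; apply: filterS => i; rewrite /= !eval_power.
- by split=> // U0; apply: filter_not_empty U0.
- rewrite IHp IHq; split=> [pq|Upq Up]; last first.
    by apply: filterS (filterI Upq Up) => i [H /H].
  have [/pq|] := in_ultra_setVsetC [set i | sat (e^~ i) p] hU.
    by apply: filterS => i qi _.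
  by apply: filterS => i /= np /np.
have updE (a : I -> A) i : (fun m => update e n a m i) = update (e^~ i) n (a i).
  by apply: funext => m; rewrite /update; case: ifP.
have updC (a : I -> A) : update (fun m => ultra_class (e m)) n (ultra_class a) =
    fun m => ultra_class (update e n a m).
  by apply: funext => m; rewrite /update; case: ifP.
split=> [H|H C]; last first.
  rewrite -[C]quot_reprK [quot_class _ _]/(ultra_class _) updC; apply/IH.
  by apply: filterS H => i /= /(_ (quot_repr C i)); rewrite updE.
(* [a i] is a counterexample at coordinate [i] whenever one exists, so truth at this single element
   yields truth at all. *)
have [a aP] : exists a : I -> A, forall i,
    sat (update (e^~ i) n (a i)) p -> forall b, sat (update (e^~ i) n b) p.
  suff /choice[a aP] : forall i, exists b, sat (update (e^~ i) n b) p ->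
      forall c, sat (update (e^~ i) n c) p by exists a.
  move=> i.
  have [a0] := carrier_inhabited A.
  have [|/existsNP[b nb]] := pselect (forall b, sat (update (e^~ i) n b) p).
    by exists a0.
  by exists b.
have := H (ultra_class a); rewrite updC => /IH.
by apply: filterS => i /=; rewrite updE => /aP.
Qed.

(** For constant families the index set in [Los] is everything or empty. *)
Lemma ultrapower_elementary : elementary_extension A ultrapower.
Proof.
exists (fun a => ultra_class (fun=> a)) => phi e.
rewrite (Los phi (fun n _ => e n)); split=> [H|/filter_ex[]//].
exact: filterS filterT.
Qed.

End Ultrapower.

Section FiniteParts.
Variables (L : language) (A B : algebra L).

(* The pair (f, x) stands for the instance f(x) = interp x of the positive
   diagram of A. *)
Definition diagram : Type := {f : L & 'I_(arity f) -> A}.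

Definition preserves (h : A -> B) (c : diagram) : Prop :=
  h (interp (projT2 c)) = interp (h \o projT2 c).

Lemma hom_of_finite_parts :
  (forall D : seq diagram, exists h : A -> B, Forall (preserves h) D) ->
  exists C : algebra L, elementary_extension B C /\ admits_hom A C.
Proof.
move=> /choice[h hP].
(* These sets generate a proper filter: [up (D ++ E)] lies within [up D] and [up E], and [D] belongs
   to [up D]. *)
pose up (D : seq diagram) := [set D' | List.incl D D'].
have upF : Filter (filter_from setT up).
  apply: filter_from_filter; first by exists [::].
  move=> D E _ _; exists (D ++ E) => // D' DE.
  by split=> c cD; apply: DE; apply: in_or_app; [left|right].
have upP : ProperFilter (filter_from setT up).
  by apply: filter_from_proper => D _; exists D => c.
have [U [hU upU]] := ultraFilterLemma upP.
exists (ultrapower B hU); split; first exact: ultrapower_elementary.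
(* The maps [h D] need not agree with one another, but each instance is preserved by [h D] as soon
   as [D] contains it, hence for almost all [D]. *)
exists (fun a => ultra_class hU (h^~ a)) => f x; rewrite /ultra_class.
rewrite -(quot_class_hom (A := power B _)); apply/quot_classE => /=.
have : U (up [:: existT _ f x]) by apply: upU; exists [:: existT _ f x].
apply: filterS => D; rewrite /up /= => /(_ _ (or_introl erefl)) cD.
by have /Forall_forall/(_ _ cD) := hP D.
Qed.

End FiniteParts.

(** * The equivalence *)

Section Equivalence.
Variables (L : language) (Q : algebra L -> Prop) (hQ : quasivariety Q).

(* Codes of elements start at 2, keeping the variables 0 and 1 fresh. *)
Lemma finite_part_realizable (A : algebra L) (D : seq (diagram A)) :
  structurally_complete Q -> Q A -> ~ trivial A ->
  exists h : A -> F_omega Q, Forall (preserves h) D.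
Proof.
move=> SC QA ntA; have [a0] := carrier_inhabited A.
have [b nb] : exists b : A, b <> a0.
  by apply: contrapT => /forallNP H; apply: ntA; exists a0 => b; apply: contrapT.
pose elts (c : diagram A) : seq {classic A} :=
  interp (projT2 c) :: [seq projT2 c i | i <- enum 'I_(arity (projT1 c))].
pose s := flatten (map elts D).
(* Elements outside [s] all share one code; this is harmless, as [D] mentions only elements of
   [s]. *)
pose code (a : A) := (index (a : {classic A}) s).+2.
pose eqn (c : diagram A) : equation L :=
  (Var L (code (interp (projT2 c))), App (fun i => Var L (code (projT2 c i)))).
pose q := QuasiIdentity (map eqn D) (Var L 0, Var L 1).
apply: contrapT => /forallNP nh.
(* Vacuously: a solution [e] of the premise would make [e \o code] preserve [D]. *)
have adm : admissible Q q.
  move=> e prem; case: (nh (e \o code)); apply/Forall_forall => c cD.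
  by move/Forall_forall: prem => /(_ _ (in_map eqn _ _ cD)).
(* Decodes on [s], and sends the fresh variables 0 and 1 to the distinct [a0] and [b]. *)
pose e n : A := if n is m.+1 then (if m is l.+1 then nth a0 (s : seq A) l else b) else a0.
have := SC q adm A QA e; rewrite /eq_holds /= => H; apply: nb; symmetry; apply: H.
have eK a : a \in s -> e (code a) = a by exact: (@nth_index {classic A}).
have sP c a : In c D -> a \in elts c -> a \in s.
  rewrite /s; elim: (D) => [//|d D' IH] /= [->|/IH{}IH /IH] ac.
    by rewrite -cat_cons mem_cat ac.
  by rewrite -cat_cons mem_cat ac orbT.
apply/Forall_forall => _ /in_map_iff[c [<- cD]].
rewrite /eq_holds -[LHS]/(e (code _)) eK; last by apply: sP cD _; rewrite mem_head.
congr (interp _); apply: funext => i; symmetry; apply/eK/(sP _ _ cD).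
by rewrite inE map_f ?orbT // mem_enum.
Qed.

Lemma finitely_presented_Q (A : algebra L) : finitely_presented Q A -> Q A.
Proof.
move=> [k [ne [H [_ [i [ih /bij_inj iI]]]]]].
exact: quasivariety_inj hQ ih iI (theta_Q_congruence H hQ).
Qed.

Lemma finitely_presented_hom (A : algebra L) :
  finitely_presented Q A ->
  (exists B, elementary_extension (F_omega Q) B /\ admits_hom A B) ->
  admits_hom A (F_omega Q).
Proof.
move=> [k [ne [H [/finite_set_In[l lP] [i [ih [i' iK i'K]]]]]]] [B [FB [h hh]]].
have i'h : is_hom i'.
  move=> f x; apply: (can_inj iK); rewrite i'K ih.
  by congr (interp _); apply: funext => n; rewrite i'K.
have gE := eval_presented_class (hom_comp hh i'h).
(* The relations as equations between representing terms; the images of the generators in [B] solve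
   them. *)
pose s := [seq (quot_repr p.1, quot_repr p.2) | p <- l].
have [|g' g'P] := elementary_extension_solution (s := s)
    (g := (h \o i') \o (presented_class H \o @Var L 'I_k)) FB.
  move=> _ /in_map_iff[p [<- /lP Hp]]; rewrite !gE /=; congr (h (i' _)).
  by apply/quot_classE; rewrite /free_class !quot_reprK; exact: theta_sub.
have [[c d] Hp|k' [k'h _]] := presented_lift (H := H) hQ (g := g') (F_omega_Q hQ).
  exists (quot_repr c), (quot_repr d); rewrite /free_class !quot_reprK; split=> //.
  apply: (g'P (quot_repr c, quot_repr d)); apply/in_map_iff.
  by exists (c, d); split=> //; apply/lP.
by exists (k' \o i); exact: hom_comp.
Qed.

Lemma passive_qi_holds (q : quasi_identity L) :
  (forall A : algebra L, finitely_presented Q A -> ~ trivial A ->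
     admits_hom A (F_omega Q)) ->
  passive Q q -> forall A, Q A -> qi_holds A q.
Proof.
move=> fpF [_ noF] A QA e prem.
have [k kP] := equations_finite_support (conclusion q :: premise q).
(* One generator more than the bound ensures that a term exists and that [inord] is available. *)
pose ne := inhabits (Var L (ord0 : 'I_k.+1)).
pose tr := @rename_eq L _ _ (inord : nat -> 'I_k.+1).
(* [inord] distorts only variables beyond the bound, on which these equations do not depend. *)
have evalI (B : algebra L) (e' : nat -> B) p : In p (conclusion q :: premise q) ->
    eq_holds e' p <->
    eval (e' \o @nat_of_ord k.+1) (tr p).1 = eval (e' \o @nat_of_ord k.+1) (tr p).2.
  move=> pq; rewrite !eval_rename -/(eq_holds _ p).
  have /Forall_forall : Forall (fun r => eq_holds e' r <->
      eq_holds (fun n => e' (inord n : 'I_k.+1)) r) (conclusion q :: premise q).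
    by apply: kP => n nk; rewrite inordK // ltnW.
  exact.
pose cl := free_class Q ne.
pose l := map (fun p => (cl (tr p).1, cl (tr p).2)) (premise q).
pose H : set (free_algebra Q ne * free_algebra Q ne) := [set c | In c l].
pose P := quotient (theta Q H).
have Hprem p : In p (premise q) ->
    presented_class H (tr p).1 = presented_class H (tr p).2.
  move=> pq; apply/quot_classE; apply: (theta_sub (p := (_, _))).
  by apply/in_map_iff; exists p.
(* Otherwise the images of the generators in [F_omega Q] would solve the premise. *)
have [c cP] : trivial P.
  apply: contrapT => ntP.
  have [|h hh] := fpF P _ ntP.
    exists k.+1, ne, H; split; first by apply/finite_set_In; exists l.
    by exists id; split=> //; exists id.
  apply: (noF ((h \o (presented_class H \o @Var L 'I_k.+1)) \o inord)).
  apply/Forall_forall => p pq; apply/eq_holds_comp.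
  by rewrite !(eval_presented_class hh) Hprem.
have [_ /in_map_iff[p [<- pq]]|h [_ hE]] :=
    presented_lift (H := H) hQ (g := e \o @nat_of_ord k.+1) QA.
  exists (tr p).1, (tr p).2; split=> //; apply/evalI; first by right.
  by move/Forall_forall: prem; apply.
apply/evalI; first by left.
(* Both sides of the conclusion are images of the only element of [P]. *)
by rewrite -!hE (cP (presented_class H _)) [in RHS](cP (presented_class H _)).
Qed.

End Equivalence.

Theorem theorem3p2 (L : language) (Q : algebra L -> Prop)
    (hQ : quasivariety Q) (hASC : almost_structurally_complete Q) :
  (structurally_complete Q <->
   (forall A : algebra L, Q A -> ~ trivial A ->
      exists B : algebra L, elementary_extension (F_omega Q) B /\ admits_hom A B)) /\
  ((forall A : algebra L, Q A -> ~ trivial A ->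
      exists B : algebra L, elementary_extension (F_omega Q) B /\ admits_hom A B) <->
   (forall A : algebra L, finitely_presented Q A -> ~ trivial A ->
      admits_hom A (F_omega Q))).
Proof.
set c1 := structurally_complete Q.
set c2 := forall A : algebra L, Q A -> _.
set c3 := forall A : algebra L, finitely_presented Q A -> _.
have h12 : c1 -> c2.
  move=> SC A QA ntA; apply: hom_of_finite_parts => D.
  exact: finite_part_realizable.
have h23 : c2 -> c3.
  move=> H A fpA ntA; apply: finitely_presented_hom => //; apply: H => //.
  exact: finitely_presented_Q.
have h31 : c3 -> c1.
  move=> H q adm; have [/hASC//|nact] := pselect (active Q q).
  by apply: passive_qi_holds => //; apply: contrapT => np; apply: nact.
by split; split; auto.
Qed.
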